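(* Let $a>0$ and let $\tau\in\mathcal{R}(a)$. Set $t^*:=\left\|\tau(\cdot)-\frac a2\right\|_\infty$. Then $$\sup_{\xi\in\mathcal{H}^\omega(a)}\mathbb{E}\left|\int_0^a\xi_t\,dt-a\cdot\xi_\tau\right|=\int_0^{\frac a2-t^*}\omega(s)\,ds+\int_0^{\frac a2+t^*}\omega(s)\,ds.$$
   Context: $(\Omega,\mathcal{F},P)$ is a fixed probability space and $\mathbb{E}$ denotes expectation. For a random variable $\eta$ on it, $\|\eta\|_\infty:=\operatorname{ess\,sup}_{w\in\Omega}|\eta(w)|$. For $a>0$, $\mathcal{R}(a)$ is the set of all random variables $\eta$ on $(\Omega,\mathcal{F},P)$ with $\eta(w)\in[0,a]$ for all $w\in\Omega$. $\omega$ is a fixed concave modulus of continuity: a continuous non-decreasing concave function $\omega\colon[0,\infty)\to[0,\infty)$ with $\omega(0)=0$. $\mathcal{H}^\omega(a)$ is the class of all (jointly) measurable real-valued random processes $\xi_t$, $t\in[0,a]$, on $(\Omega,\mathcal{F},P)$ such that $\mathbb{E}|\xi_\tau-\xi_\theta|\le\omega(\|\tau-\theta\|_\infty)$ for all $\tau,\theta\in\mathcal{R}(a)$. Here, for $\tau\in\mathcal{R}(a)$, $\xi_\tau$ is the random variable $w\mapsto\xi_{\tau(w)}(w)$. *)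

(* Defs.v *)
From HB Require Import structures.
From mathcomp Require Import all_boot all_order all_algebra.
From mathcomp Require Import all_classical all_reals all_analysis.
From mathcomp Require Import ess_sup_inf.

Set Implicit Arguments.
Unset Strict Implicit.
Unset Printing Implicit Defensive.

Import Order.TTheory GRing.Theory Num.Theory.
Import numFieldNormedType.Exports.

Local Open Scope classical_set_scope.
Local Open Scope ring_scope.
Local Open Scope convex_scope.

(* The mirror image of the library's [convex_function]. *)
Definition concave_function (R : numFieldType) (E : lmodType R)
    (E' := convex_lmodType E) (D : set E') (f : E' -> R^o) :=
  forall t : {i01 R},
    {in D &, forall x y : E', f x <| t |> f y <= f (x <| t |> y)}.

(* A function on [0, +oo[ is a total function of which only the values on
   [0, +oo[ are constrained (and used). *)
Record concave_modulus (R : realType) (omega : R -> R) : Prop := {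
  modulus_continuous : {within `[0, +oo[, continuous omega} ;
  modulus_nondecreasing :
    {in `[0, +oo[ &, {homo omega : x y / x <= y}} ;
  modulus_concave : concave_function (`[0, +oo[%classic : set R) omega ;
  modulus_ge0 : forall x, 0 <= x -> 0 <= omega x ;
  modulus0 : omega 0 = 0 }.

(* Real-valued: the essential supremum is finite for (essentially) bounded X,
   the only case in which the norm is used; for other X the value is junk. *)
Definition norm_infty d (T : measurableType d) (R : realType)
    (P : probability T R) (X : T -> R) : R :=
  fine (ess_sup P (fun w => `|X w|%:E)).

Definition random_times d (T : measurableType d) (R : realType)
    (P : probability T R) (a : R) : set {RV P >-> R} :=
  [set eta | forall w, 0 <= eta w <= a].
Arguments random_times {d T R} P a.

Definition sample d (T : measurableType d) (R : realType)
    (xi : R -> T -> R) (tau : T -> R) : T -> R :=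
  fun w => xi (tau w) w.

(* A process indexed by [0, a] is a family xi : R -> T -> R of which only the
   values at times t in [0, a] are constrained (and used).  Joint measurability
   is with respect to the product of the Borel sigma-algebra of [0, a] and the
   sigma-algebra of T. *)
Definition H_class d (T : measurableType d) (R : realType)
    (P : probability T R) (omega : R -> R) (a : R) : set (R -> T -> R) :=
  [set xi : R -> T -> R |
    measurable_fun (`[0, a] `*` [set: T]) (fun p : R * T => xi p.1 p.2) /\
    forall tau theta : {RV P >-> R},
      random_times P a tau -> random_times P a theta ->
      ('E_P[fun w => `|sample xi tau w - sample xi theta w|%R]
        <= (omega (norm_infty P (fun w => tau w - theta w)%R))%:E)%E].

(* For xi in [H_class P omega a], the path t |-> xi t w is Lebesgue integrable
   on [0, a] for P-almost every w; on the remaining null set the value of the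
   integral below is junk, which does not affect expectations. *)
Definition path_integral d (T : measurableType d) (R : realType)
    (a : R) (xi : R -> T -> R) : T -> R :=
  fun w => \int[lebesgue_measure]_(t in `[0, a]) xi t w.

(* Main.v *)
(* Upper bound.  Put h = a/2 - t*, so that tau lies in [h, a - h] almost surely.
   For x in [h, a - h], [0, a] can be swept by two measure-preserving families
   of points, one indexed by s in [0, a - h] and one by s in [0, h], in such a
   way that the point of index s is at distance at most s from x: go from x
   towards the farther end of [0, a] and continue from the opposite end (by then
   s > a/2, and the wrapped point is at distance a - s), and fill the remaining
   gap from x in the other direction.  Substituting x = tau(w) makes each swept
   point a random time at L^oo-distance at most s from tau, and Tonelli's
   theorem integrates the bound omega(s).

   Lower bound.  For an event A of positive probability on which |tau - a/2| is
   within delta of t*, the process 1_A / P(A) * omega(|t - tau|) belongs to the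
   class because omega is subadditive; it vanishes at tau, and the mean of its
   path integral is within a * omega(delta) of the right-hand side. *)

Require Import Defs.
From HB Require Import structures.
From mathcomp Require Import all_boot all_order all_algebra.
From mathcomp Require Import all_classical all_reals all_analysis.
From mathcomp Require Import ess_sup_inf measurable_realfun lra.

Set Implicit Arguments.
Unset Strict Implicit.
Unset Printing Implicit Defensive.

Import Order.TTheory GRing.Theory Num.Theory.
Import numFieldNormedType.Exports.

Local Open Scope classical_set_scope.
Local Open Scope ring_scope.

(** * Lebesgue integrals under reflections, shifts and splitting of an interval *)

Section lebesgue_affine.
Context {R : realType}.
Local Notation mu := (@lebesgue_measure R).
Implicit Types (e b c m x h a : R) (g : R -> \bar R).

Lemma measurable_reflect e :
  measurable_fun setT ((fun s => e - s) : measurableTypeR R -> measurableTypeR R).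
Proof. exact: (@measurable_funB _ _ R setT (cst e) id). Qed.

(** Lebesgue measure is determined by its values on intervals []x, y]], and the preimage [[e - y, e
    - x[] of such an interval has the same length. *)
Lemma lebesgue_measure_reflect e (A : set R) : measurable A ->
  mu A = pushforward mu ((fun s => e - s) : measurableTypeR R -> measurableTypeR R) A.
Proof.
move=> mA; apply: lebesgue_measure_unique => //=.
  exact: measurable_reflect.
move=> me _ [[x y] /= xy <-]; rewrite /pushforward.
have -> : (fun s => e - s) @^-1` `]x, y] = `[e - y, e - x[%classic.
  apply/seteqP; split => z /=; rewrite !in_itv/= => /andP[? ?];
    by apply/andP; split; lra.
rewrite !lebesgue_measure_itv/= !lte_fin ltrD2l ltrN2.
by case: ifPn => // _; congr (_%:E); lra.
Qed.

Lemma integral_reflect e b c g : measurable_fun setT g ->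
  (forall x, 0 <= g x)%E ->
  (\int[mu]_(s in `[b, c]) g (e - s)%R =
   \int[mu]_(t in `[(e - c)%R, (e - b)%R]) g t)%E.
Proof.
move=> mg g0.
have -> : `[b, c]%classic = (fun s => e - s) @^-1` `[e - c, e - b].
  apply/seteqP; split => z /=; rewrite !in_itv/= => /andP[? ?];
    by apply/andP; split; lra.
rewrite -[LHS](@ge0_integral_pushforward _ _ _ _ _ _ (measurable_reflect e) mu
  `[e - c, e - b] g)//=; last exact: measurable_funTS.
apply: eq_measure_integral => //= [|me A mA _]; first exact: measurable_reflect.
by rewrite -lebesgue_measure_reflect.
Qed.

(** A shift is the composition of two reflections. *)
Lemma integral_shift e b c g : measurable_fun setT g ->
  (forall x, 0 <= g x)%E ->
  (\int[mu]_(s in `[b, c]) g (e + s)%R =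
   \int[mu]_(t in `[(e + b)%R, (e + c)%R]) g t)%E.
Proof.
move=> mg g0.
have := @integral_reflect 0 b c (fun u => g (e - u)).
rewrite integral_reflect// !sub0r !opprK => <- //.
- by apply: eq_integral => s _; rewrite sub0r opprK.
- by apply: measurableT_comp => //; exact: measurable_funB.
Qed.

Lemma integral_itv_split b m c g : measurable_fun setT g ->
  (forall x, 0 <= g x)%E -> b <= m -> m <= c ->
  (\int[mu]_(t in `[b, c]) g t =
   \int[mu]_(t in `[b, m]) g t + \int[mu]_(t in `[m, c]) g t)%E.
Proof.
move=> mg g0 bm mc.
rewrite (@itv_bndbnd_setU _ _ _ (BRight m))//.
rewrite ge0_integral_setU//; last 2 first.
- exact: measurable_funTS.
- apply/disj_setPS => y [/=]; rewrite 2!in_itv/= => /andP[_ yx] /andP[].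
  by rewrite ltNge yx.
by rewrite integral_itv_obnd_cbnd//; exact: measurable_funTS.
Qed.

End lebesgue_affine.

(** * The two measure-preserving sweeps of [0, a] starting from a point *)

Section sweep.
Context {R : realType}.
Local Notation mu := (@lebesgue_measure R).
Implicit Types (a x h s : R).

(* x + s and x - s wrapped around modulo a, moving first towards the farther end
   of [0, a]. *)
Definition sweep_far a x s : R :=
  if x <= a / 2 then (if s <= a - x then x + s else x + s - a)
  else (if s <= x then x - s else x - s + a).

(** Moves towards the nearer end, and so fills the gap of length h next to x that [sweep_far] leaves
    when its index stops at a - h. *)
Definition sweep_near a x s : R := if x <= a / 2 then x - s else x + s.

Lemma sweep_far_itv a x h s : 0 <= h -> h <= x <= a - h -> 0 <= s <= a - h ->
  0 <= sweep_far a x s <= a.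
Proof.
rewrite /sweep_far => h0 /andP[hx xh] /andP[s0 sh].
by case: (lerP x (a / 2)) => ?; [case: (lerP s (a - x)) => ?|case: (lerP s x) => ?];
   apply/andP; split; lra.
Qed.

Lemma sweep_near_itv a x h s : 0 <= h -> h <= x <= a - h -> 0 <= s <= h ->
  0 <= sweep_near a x s <= a.
Proof.
rewrite /sweep_near => h0 /andP[hx xh] /andP[s0 sh].
by case: (lerP x (a / 2)) => ?; apply/andP; split; lra.
Qed.

Lemma sweep_far_dist a x h s : 0 <= h -> h <= x <= a - h -> 0 <= s <= a - h ->
  `|sweep_far a x s - x| <= s.
Proof.
rewrite /sweep_far => h0 /andP[hx xh] /andP[s0 sh].
by case: (lerP x (a / 2)) => ?; [case: (lerP s (a - x)) => ?|case: (lerP s x) => ?];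
   rewrite ler_norml; apply/andP; split; lra.
Qed.

Lemma sweep_near_dist a x s : 0 <= s -> `|sweep_near a x s - x| <= s.
Proof.
rewrite /sweep_near => s0.
by case: (lerP x (a / 2)) => ?; rewrite ler_norml; apply/andP; split; lra.
Qed.

Lemma measurable_sweep_far a : measurable_fun setT
  (fun p : R * R => sweep_far a p.1 p.2).
Proof.
have m1 : measurable_fun setT (fst : R * R -> R) by exact: measurable_fst.
have m2 : measurable_fun setT (snd : R * R -> R) by exact: measurable_snd.
apply: measurable_fun_ifT; first exact: measurable_fun_ler.
  apply: measurable_fun_ifT.
  - by apply: measurable_fun_ler => //; exact: measurable_funB.
  - exact: measurable_funD.
  - by apply: measurable_funB => //; exact: measurable_funD.
apply: measurable_fun_ifT.
- exact: measurable_fun_ler.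
- exact: measurable_funB.
- by apply: measurable_funD => //; exact: measurable_funB.
Qed.

Lemma measurable_sweep_near a : measurable_fun setT
  (fun p : R * R => sweep_near a p.1 p.2).
Proof.
have m1 : measurable_fun setT (fst : R * R -> R) by exact: measurable_fst.
have m2 : measurable_fun setT (snd : R * R -> R) by exact: measurable_snd.
apply: measurable_fun_ifT; first exact: measurable_fun_ler.
  exact: measurable_funB.
exact: measurable_funD.
Qed.

(** The interval splits into [x, a], swept before wrapping, [0, x - h], swept after wrapping, and
    [x - h, x], swept backwards from x. *)
Lemma integral_sweep_lo a x h (g : R -> \bar R) : measurable_fun setT g ->
  (forall t, 0 <= g t)%E -> 0 <= h -> h <= x <= a / 2 ->
  (\int[mu]_(t in `[0%R, a]) g t =
   \int[mu]_(s in `[0%R, (a - h)%R])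
     g (if s <= a - x then x + s else x + s - a)%R +
   \int[mu]_(s in `[0%R, h]) g (x - s)%R)%E.
Proof.
move=> mg g0 h0 /andP[hx xa].
have mG : measurable_fun setT
    (fun s : R => g (if s <= a - x then x + s else x + s - a)%R).
  apply: measurableT_comp => //; apply: measurable_fun_ifT.
  - exact: measurable_fun_ler.
  - exact: measurable_funD.
  - by apply: measurable_funB => //; exact: measurable_funD.
rewrite (integral_itv_split (b := 0) (m := a - x) (c := a - h))//; [|lra|lra].
rewrite [X in ((X + _) + _)%E](_ : _ =
  \int[mu]_(s in `[0%R, (a - x)%R]) g (x + s)%R)%E; last first.
  by apply: eq_integral => s; rewrite inE/= in_itv/= => /andP[_ ->].
rewrite [X in ((_ + X) + _)%E](_ : _ =
  \int[mu]_(s in `[(a - x)%R, (a - h)%R]) g ((x - a) + s)%R)%E; last first.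
  (* At s = a - x the conditional still takes the unwrapped branch, so this endpoint, a null set, is
     removed on both sides. *)
  rewrite -integral_itv_obnd_cbnd; last exact: measurable_funTS.
  rewrite -[RHS]integral_itv_obnd_cbnd; last first.
    by apply/measurable_funTS/measurableT_comp => //; exact: measurable_funD.
  apply: eq_integral => s; rewrite inE/= in_itv/= => /andP[sx _].
  by rewrite leNgt sx/= addrAC.
rewrite !integral_shift// integral_reflect//.
have -> : x + (a - x) = a by lra.
have -> : x - a + (a - x) = 0 by lra.
have -> : x - a + (a - h) = x - h by lra.
rewrite addr0 subr0.
rewrite (integral_itv_split (b := 0) (m := x) (c := a))//; [|lra..].
rewrite (integral_itv_split (b := 0) (m := x - h) (c := x))//; [|lra..].
by rewrite addeC addeA.
Qed.

Lemma integral_sweep a x h (g : R -> \bar R) : measurable_fun setT g ->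
  (forall t, 0 <= g t)%E -> 0 <= h -> h <= x <= a - h ->
  (\int[mu]_(t in `[0%R, a]) g t =
   \int[mu]_(s in `[0%R, (a - h)%R]) g (sweep_far a x s) +
   \int[mu]_(s in `[0%R, h]) g (sweep_near a x s))%E.
Proof.
move=> mg g0 h0 /andP[hx xh]; rewrite /sweep_far /sweep_near.
case: (lerP x (a / 2)) => xa; first by rewrite (integral_sweep_lo (x := x) (h := h))// hx.
(* The reflection t -> a - t exchanges x with a - x <= a / 2 and reduces to the previous case. *)
have := @integral_reflect _ a 0 a g mg g0; rewrite subrr subr0 => <-.
rewrite (@integral_sweep_lo a (a - x) h)//; last first.
- by apply/andP; split; lra.
- by apply: measurableT_comp => //; exact: measurable_funB.
congr (_ + _)%E; apply: eq_integral => s _.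
  rewrite (_ : a - (a - x) = x)%R; last lra.
  by case: (lerP s x) => ?; congr g; lra.
by congr g; lra.
Qed.

End sweep.

(** * Consequences of concavity and continuity of the modulus *)

Section modulus.
Context {R : realType}.
Local Notation mu := (@lebesgue_measure R).
Variables (omega : R -> R) (homega : concave_modulus omega).
Implicit Types (a x y h e : R).

Lemma modulus_le x y : 0 <= x -> x <= y -> omega x <= omega y.
Proof.
move=> x0 xy; apply: (modulus_nondecreasing homega) => //.
  by rewrite in_itv/= x0.
by rewrite in_itv/= (le_trans x0 xy).
Qed.

(** Concavity between x and 0, where [omega] vanishes. *)
Lemma modulus_scale t x : 0 <= t <= 1 -> 0 <= x -> t * omega x <= omega (t * x).
Proof.
move=> /andP[t0 t1] x0.
have : t * omega x + (1 - t) * omega 0 <= omega (t * x + (1 - t) * 0).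
  by apply: (modulus_concave homega (Itv01 t0 t1));
    rewrite inE/= in_itv/= ?x0 ?lexx.
by rewrite (modulus0 homega) !mulr0 !addr0.
Qed.

(** By scaling, [omega x] and [omega y] each dominate their proportional share of
    [omega (x + y)]. *)
Lemma modulus_subadditive x y : 0 <= x -> 0 <= y ->
  omega (x + y) <= omega x + omega y.
Proof.
rewrite le_eqVlt => /predU1P[<- y0|x0 y0].
  by rewrite add0r lerDr (modulus_ge0 homega).
have xy0 : 0 < x + y by rewrite ltr_pwDl.
have scale z : 0 <= z <= x + y -> z / (x + y) * omega (x + y) <= omega z.
  move=> /andP[z0 zxy].
  have := @modulus_scale (z / (x + y)) (x + y).
  rewrite divfK ?gt_eqF//; apply; last exact: ltW.
  by rewrite divr_ge0 ?(ltW xy0)//= ler_pdivrMr// mul1r.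
apply: (@le_trans _ _ (x / (x + y) * omega (x + y) + y / (x + y) * omega (x + y))).
  by rewrite -mulrDl -mulrDl divff ?gt_eqF// mul1r.
by apply: lerD; apply: scale; rewrite ?(ltW x0) ?y0 ?lerDl ?lerDr ?(ltW x0).
Qed.

(** For |y| <= |x|, apply monotonicity and subadditivity to |x| <= |x - y| + |y|. This is what puts
    the extremal process into the class. *)
Lemma modulus_dist x y : `|omega `|x| - omega `|y| | <= omega `|x - y|.
Proof.
wlog yx : x y / `|y| <= `|x|.
  move=> H; case: (lerP `|y| `|x|) => [|/ltW] xy; first exact: H.
  by rewrite distrC (distrC x y); exact: H.
rewrite ger0_norm ?subr_ge0 ?modulus_le// lerBlDr.
rewrite (le_trans _ (modulus_subadditive _ _))//.
by rewrite modulus_le// -[in leLHS](subrK y x) ler_normD.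
Qed.

(** The absolute value keeps the argument in [0, +oo[, the only place where [omega] is
    constrained. *)
Lemma measurable_modulus_norm : measurable_fun setT (fun x => omega `|x|).
Proof.
have mo : measurable_fun (`[0, +oo[ : set R) omega.
  by apply: subspace_continuous_measurable_fun => //; exact: modulus_continuous.
apply: (measurable_comp _ _ mo); [by []| |exact: normr_measurable].
by move=> _ [x _ <-]; rewrite /= in_itv/= normr_ge0.
Qed.

Lemma modulus_small e : 0 < e -> exists2 t, 0 < t & omega t < e.
Proof.
move=> e0.
have [_] := (continuous_within_itvcyP _ _).1 (modulus_continuous homega).
move/cvgrPdist_lt => /(_ _ e0) /= H.
have : \forall t \near 0^'+, 0 < t /\ omega t < e.
  near=> t; split; first by near: t; exact: nbhs_right_gt.
  have : `|omega 0 - omega t| < e by near: t.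
  by rewrite (modulus0 homega) sub0r normrN; exact: le_lt_trans (ler_norm _).
by move=> /filter_ex[t [t0 te]]; exists t.
Unshelve. all: by end_near. Qed.

Lemma integrable_modulus b : mu.-integrable `[0, b] (EFin \o omega).
Proof.
apply: continuous_compact_integrable; first exact: segment_compact.
apply: continuous_subspaceW (modulus_continuous homega) => x /=.
by rewrite !in_itv/= => /andP[->].
Qed.

Lemma integral_modulusE b :
  (\int[mu]_(s in `[0%R, b]) (omega s)%:E)%E = (\int[mu]_(s in `[0, b]) omega s)%:E.
Proof. by rewrite fineK// integrable_fin_num//; exact: integrable_modulus. Qed.

(** From an endpoint of [h, a - h] the far sweep never wraps, so in both sweeps the point of index s
    is at distance exactly s from x. *)
Lemma integral_modulus_dist a h x : 0 <= h <= a / 2 -> x = h \/ x = a - h ->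
  (\int[mu]_(t in `[0%R, a]) (omega `|t - x|)%:E =
   (\int[mu]_(s in `[0, h]) omega s + \int[mu]_(s in `[0, a - h]) omega s)%:E)%E.
Proof.
move=> /andP[h0 ha] xh.
have hx : h <= x <= a - h by case: xh => ->; apply/andP; split; lra.
rewrite (@integral_sweep _ a x h)//; last 2 first.
- apply: measurableT_comp => //; apply: (measurableT_comp measurable_modulus_norm).
  exact: measurable_funB.
- by move=> t; rewrite lee_fin (modulus_ge0 homega).
rewrite EFinD -!integral_modulusE [RHS]addeC.
congr (_ + _)%E; apply: eq_integral => s; rewrite inE/= in_itv/= => /andP[s0 sh].
  have farE : sweep_far a x s = x + s \/ sweep_far a x s = x - s.
    rewrite /sweep_far; case: (lerP x (a / 2)) => ?.
      by left; rewrite ifT//; case: xh; lra.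
    by right; rewrite ifT//; case: xh; lra.
  by case: farE => ->; rewrite addrAC subrr add0r ?normrN ger0_norm.
rewrite /sweep_near; case: ifP => _.
  by rewrite addrAC subrr add0r normrN ger0_norm.
by rewrite addrAC subrr add0r ger0_norm.
Qed.

End modulus.

(** * Monotonicity of nonnegative integrals *)

Section measure_facts.
Local Open Scope ereal_scope.
Context d (T : measurableType d) (R : realType).
Variable m : {measure set T -> \bar R}.

(** The integral of a nonnegative function is the supremum over the simple functions below it, a
    family that grows with the function. Integrands built from [path_integral] can thus be compared
    directly. *)
Lemma ge0_le_integral_nomeas (D : set T) (f g : T -> \bar R) :
  (forall x, D x -> 0 <= f x) -> (forall x, D x -> f x <= g x) ->
  \int[m]_(x in D) f x <= \int[m]_(x in D) g x.
Proof.
move=> f0 fg; rewrite !ge0_integralE//; last first.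
  by move=> x Dx; exact: le_trans (f0 x Dx) (fg x Dx).
apply: le_ereal_sup => _ [h hf <-]; exists h => // x.
exact: le_trans (hf x) (lee_restrict fg x).
Qed.

End measure_facts.

(** * Distance from an integral over [0, a] to a constant *)

Section real_facts.
Context {R : realType}.
Local Notation mu := (@lebesgue_measure R).

(* No integrability of [f] is assumed: if [f] is not integrable on [0, a], the
   right-hand side is +oo. *)
Lemma dist_Rintegral_cst (a c : R) (f : R -> R) : 0 <= a ->
  measurable_fun setT f ->
  ((`|\int[mu]_(t in `[0, a]) f t - a * c|)%:E <=
   \int[mu]_(t in `[0%R, a]) (`|f t - c|)%:E)%E.
Proof.
move=> a0 mf.
have mfc : measurable_fun setT (fun t => f t - c) by exact: measurable_funB.
have [/eqP -> | fin] := boolP (\int[mu]_(t in `[0%R, a]) (`|f t - c|)%:E == +oo)%E.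
  exact: leey.
have ifc : mu.-integrable `[0, a] (EFin \o (fun t => f t - c)).
  apply/integrableP; split; first exact/measurable_funTS/measurableT_comp.
  by rewrite ltey.
have ic : mu.-integrable `[0, a] (EFin \o cst c).
  apply: continuous_compact_integrable; first exact: segment_compact.
  by apply: continuous_subspaceT => x; exact: cvg_cst.
have if_ : mu.-integrable `[0, a] (EFin \o f).
  by apply: eq_integrable (integrableD _ ifc ic) => // t _ /=; rewrite -EFinD subrK.
have -> : \int[mu]_(t in `[0, a]) f t - a * c = \int[mu]_(t in `[0, a]) (f t - c).
  rewrite RintegralB// Rintegral_cst//= lebesgue_measure_itv/= lte_fin.
  case: ifPn => [_|]; first by rewrite oppr0 addr0 /= mulrC.
  by rewrite -leNgt => a_; rewrite (_ : a = 0) ?mulr0 ?mul0r//; apply/le_anti/andP.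
apply: le_trans (_ : (\int[mu]_(t in `[0, a]) `|f t - c|)%:E <= _)%E.
  by rewrite lee_fin le_normr_Rintegral.
rewrite fineK// ge0_fin_numE ?ltey//.
by apply: integral_ge0.
Qed.

End real_facts.

(** * Tonelli's theorem over a compact time interval *)

Section tonelli_itv.
Context d (T : measurableType d) (R : realType) (P : probability T R).
Local Notation mu := (@lebesgue_measure R).
Variables (b : R) (k : T * R -> R).
Hypothesis mk : measurable_fun setT k.
Hypothesis k0 : forall p, 0 <= k p.

(** Extension of [k] by zero, to which Tonelli's theorem on the full product space applies. *)
Let f (p : T * R) : \bar R := (if (0 <= p.2) && (p.2 <= b) then k p else 0)%:E.

Let mf : measurable_fun setT f.
Proof.
apply: measurableT_comp => //; apply: measurable_fun_ifT => //.
apply: measurable_and; apply: measurable_fun_ler => //; exact: measurable_snd.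
Qed.

Let f0 p : (0 <= f p)%E.
Proof. by rewrite /f; case: ifPn => // _; rewrite lee_fin. Qed.

Let fE w : (\int[mu]_(s in `[0%R, b]) (k (w, s))%:E = \int[mu]_s f (w, s))%E.
Proof.
rewrite integral_mkcond; apply: eq_integral => s _.
rewrite patchE /f/=; case: ifPn; rewrite ?notin_setE ?inE/= in_itv/=.
  by move=> ->.
by move=> /negP/negbTE ->.
Qed.

Lemma measurable_integral_itv :
  measurable_fun setT (fun w => (\int[mu]_(s in `[0%R, b]) (k (w, s))%:E)%E).
Proof.
under eq_fun do rewrite fE.
exact: (@measurable_fun_fubini_tonelli_F _ _ _ _ _ mu f mf f0).
Qed.

Lemma tonelli_itv :
  (\int[P]_w \int[mu]_(s in `[0%R, b]) (k (w, s))%:E =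
   \int[mu]_(s in `[0%R, b]) \int[P]_w (k (w, s))%:E)%E.
Proof.
under eq_integral do rewrite fE.
rewrite fubini_tonelli// [RHS]integral_mkcond; apply: eq_integral => s _.
rewrite patchE; case: ifPn; rewrite ?notin_setE ?inE/= in_itv/= => sb.
  by apply: eq_integral => w _; rewrite /f/= sb.
by rewrite integral0_eq// => w _; rewrite /f/= (negbTE (introN idP sb)).
Qed.

End tonelli_itv.

(** * The essential supremum norm of a bounded variable *)

Section norm_infty.
Context d (T : measurableType d) (R : realType) (P : probability T R).
Implicit Types (X : T -> R) (s : R).

Let P0 : (0 < P setT)%E.
Proof. by rewrite probability_setT. Qed.

(** The essential supremum lies between 0 and s, so [fine] loses nothing. *)
Lemma norm_infty_fineK X s : (forall w, `|X w| <= s) ->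
  (norm_infty P X)%:E = ess_sup P (fun w => `|X w|%:E).
Proof.
move=> Xs; rewrite fineK// fin_numElt; apply/andP; split.
  apply: (@lt_le_trans _ _ 0%E); first exact: ltNyr.
  by apply: ess_sup_gee => //; apply: nearW => w; rewrite lee_fin.
apply: (@le_lt_trans _ _ s%:E); last exact: ltry.
by apply/ess_supP; apply: nearW => w; rewrite lee_fin.
Qed.

Lemma norm_infty_le X s : (forall w, `|X w| <= s) -> norm_infty P X <= s.
Proof.
move=> Xs; rewrite -lee_fin (norm_infty_fineK Xs).
by apply/ess_supP; apply: nearW => w; rewrite lee_fin.
Qed.

Lemma norm_infty_ge0 X s : (forall w, `|X w| <= s) -> 0 <= norm_infty P X.
Proof.
move=> Xs; rewrite -lee_fin (norm_infty_fineK Xs).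
by apply: ess_sup_gee => //; apply: nearW => w; rewrite lee_fin.
Qed.

Lemma norm_infty_ae X s : (forall w, `|X w| <= s) ->
  {ae P, forall w, `|X w| <= norm_infty P X}.
Proof.
move=> Xs; have := ess_sup_ge P (fun w => `|X w|%:E).
by rewrite -(norm_infty_fineK Xs); apply: filterS => w; rewrite lee_fin.
Qed.

Lemma measurable_norm_itvoc X b c : measurable_fun setT X ->
  measurable [set w | b < `|X w| <= c].
Proof.
move=> mX.
have /= := @measurable_and _ T setT (fun w => b < `|X w|) (fun w => `|X w| <= c).
move=> /(_ _ _ measurableT [set true] I); rewrite setTI; apply.
  by apply: measurable_fun_ltr => //; exact: measurableT_comp.
by apply: measurable_fun_ler => //; exact: measurableT_comp.
Qed.

(** If the event were null, the norm minus e would already be an essential bound of |X|. *)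
Lemma norm_infty_near X s e :
  measurable_fun setT X -> (forall w, `|X w| <= s) -> 0 < e ->
  (0 < P [set w | (norm_infty P X - e < `|X w| <= norm_infty P X)%R])%E.
Proof.
move=> mX Xs e0; set A := [set w | _].
rewrite lt0e measure_ge0 andbT; apply/eqP => PA.
have mA : measurable A by exact: measurable_norm_itvoc.
have : (ess_sup P (fun w => `|X w|%:E) <= (norm_infty P X - e)%:E)%E.
  have NA : {ae P, forall w, ~ A w} by exists A; split => // w /= /contrapT.
  apply/ess_supP; apply: filterS2 (norm_infty_ae Xs) NA => w Xw /negP.
  by rewrite negb_and Xw orbF -leNgt lee_fin.
by rewrite -(norm_infty_fineK Xs) lee_fin; lra.
Qed.

End norm_infty.

Lemma measurable_fun_comp2 d d1 d2 d3 (Z : measurableType d)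
    (T1 : measurableType d1) (T2 : measurableType d2) (T3 : measurableType d3)
    (F : T1 * T2 -> T3) (f : Z -> T1) (g : Z -> T2) :
  measurable_fun setT F -> measurable_fun setT f -> measurable_fun setT g ->
  measurable_fun setT (fun z => F (f z, g z)).
Proof.
by move=> mF mf mg; apply: (measurableT_comp mF); exact: measurable_fun_pair.
Qed.

(** * Upper bound for every process of the class *)

Section upper_bound.
Context d (T : measurableType d) (R : realType) (P : probability T R).
Local Notation mu := (@lebesgue_measure R).
Variables (omega : R -> R) (homega : concave_modulus omega).
Variables (a : R) (a0 : 0 <= a).

(** Serves twice: to extend processes beyond [0, a], and to turn an almost sure bound on [tau] into
    a sure one. *)
Definition clamp (b c x : R) : R := Num.max b (Num.min x c).

Lemma clamp_itv b c x : b <= c -> b <= clamp b c x <= c.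
Proof. by move=> bc; rewrite /clamp le_max lexx/= ge_max bc ge_min lexx orbT. Qed.

Lemma clamp_id b c x : b <= x <= c -> clamp b c x = x.
Proof. by move=> /andP[bx xc]; rewrite /clamp (min_idPl xc) (max_idPr bx). Qed.

Lemma measurable_clamp b c : measurable_fun setT (clamp b c).
Proof. by apply: measurable_maxr => //; exact: measurable_minr. Qed.

(** The norm of the difference lies in [0, s], and [omega] is nondecreasing there. *)
Lemma H_class_expectation_le (xi : R -> T -> R) (theta eta : T -> R) s :
  H_class P omega a xi ->
  measurable_fun setT theta -> measurable_fun setT eta ->
  (forall w, 0 <= theta w <= a) -> (forall w, 0 <= eta w <= a) ->
  (forall w, `|theta w - eta w| <= s) ->
  ('E_P[fun w => `|xi (theta w) w - xi (eta w) w|%R] <= (omega s)%:E)%E.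
Proof.
move=> [_ hxi] mtheta meta atheta aeta te.
pose th : {RV P >-> R} := HB.pack theta (isMeasurableFun.Build _ _ _ _ _ mtheta).
pose et : {RV P >-> R} := HB.pack eta (isMeasurableFun.Build _ _ _ _ _ meta).
apply: le_trans (hxi th et atheta aeta) _.
rewrite lee_fin (modulus_le homega)//.
  exact: norm_infty_ge0 te.
exact: norm_infty_le te.
Qed.

Variables (xi : R -> T -> R) (xiH : H_class P omega a xi).

(** Freezing the process at the ends of [0, a] makes it jointly measurable on the whole product and
    leaves it unchanged for times in [0, a]. *)
Let X (p : R * T) : R := xi (clamp 0 a p.1) p.2.

Let mX : measurable_fun setT X.
Proof.
case: xiH => mxi _.
apply: (measurable_comp _ _ mxi (g := fun p : R * T => (clamp 0 a p.1, p.2))).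
- by apply: measurableX => //; exact: measurable_itv.
- by move=> _ [[t w] _ <-]; split => //=; rewrite in_itv/= clamp_itv.
- apply: measurable_fun_pair; last exact: measurable_snd.
  by apply: (measurableT_comp (measurable_clamp 0 a)); exact: measurable_fst.
Qed.

Let measurable_sweep_part (eta : T -> R) (phi : R * R -> R) :
  measurable_fun setT eta -> measurable_fun setT phi ->
  measurable_fun setT
    (fun p : T * R => `|X (phi (eta p.1, p.2), p.1) - X (eta p.1, p.1)|).
Proof.
move=> meta mphi.
have m1 : measurable_fun setT (fst : T * R -> T) by exact: measurable_fst.
have m2 : measurable_fun setT (snd : T * R -> R) by exact: measurable_snd.
have me1 : measurable_fun setT (fun p : T * R => eta p.1) by exact: measurableT_comp.
apply: measurableT_comp => //; apply: measurable_funB; apply: measurable_fun_comp2 => //.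
exact: measurable_fun_comp2.
Qed.

(** After Tonelli, for each fixed s the swept point is a random time within s of [eta], so the inner
    expectation is at most [omega s]. *)
Lemma sweep_part_le (eta : T -> R) (phi : R * R -> R) b :
  measurable_fun setT eta -> (forall w, 0 <= eta w <= a) ->
  measurable_fun setT phi ->
  (forall w s, 0 <= s <= b -> 0 <= phi (eta w, s) <= a) ->
  (forall w s, 0 <= s <= b -> `|phi (eta w, s) - eta w| <= s) ->
  (\int[P]_w \int[mu]_(s in `[0%R, b])
     (`|X (phi (eta w, s), w) - X (eta w, w)|)%:E <=
   (\int[mu]_(s in `[0, b]) omega s)%:E)%E.
Proof.
move=> meta aeta mphi aphi dphi.
rewrite -(integral_modulusE homega).
pose k (p : T * R) : R := `|X (phi (eta p.1, p.2), p.1) - X (eta p.1, p.1)|.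
have mk : measurable_fun setT k := measurable_sweep_part meta mphi.
rewrite (@tonelli_itv _ _ _ P b k mk (fun=> normr_ge0 _)).
apply: ge0_le_integral_nomeas => [s _|s /=].
  by apply: integral_ge0 => w _; rewrite lee_fin normr_ge0.
rewrite in_itv/= => sb.
have mphis : measurable_fun setT (fun w => phi (eta w, s)).
  by apply: (measurableT_comp mphi); exact: measurable_fun_pair.
have := @H_class_expectation_le xi _ eta s xiH mphis meta.
rewrite unlock => H.
rewrite (eq_integral (fun w => (`|xi (phi (eta w, s)) w - xi (eta w) w|)%:E)).
  by apply: H => // w; [exact: aphi|exact: dphi].
by move=> w _; rewrite /k /X/= !clamp_id//; exact: aphi.
Qed.

Lemma expectation_path_integral_le (tau : T -> R) h :
  measurable_fun setT tau -> (forall w, 0 <= tau w <= a) ->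
  0 <= h <= a / 2 -> {ae P, forall w, h <= tau w <= a - h} ->
  ('E_P[fun w => `|path_integral a xi w - a * sample xi tau w|%R] <=
   (\int[mu]_(s in `[0, h]) omega s + \int[mu]_(s in `[0, (a - h)]) omega s)%:E)%E.
Proof.
move=> mtau atau /andP[h0 ha] htau.
have hah : h <= a - h by lra.
(* [eta] equals [tau] almost surely and lies in [h, a - h] for every w, as the sweeps require. *)
pose eta w := clamp h (a - h) (tau w).
have meta : measurable_fun setT eta by exact: (measurableT_comp (measurable_clamp _ _)).
have heta w : h <= eta w <= a - h by exact: clamp_itv.
have aeta w : 0 <= eta w <= a by have /andP[? ?] := heta w; apply/andP; split; lra.
have mXw w : measurable_fun setT (fun t => X (t, w)).
  by apply: (measurableT_comp mX); exact: measurable_fun_pair.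
pose G th w := (\int[mu]_(t in `[0%R, a]) (`|X (t, w) - X (th w, w)|)%:E)%E.
have mG th : measurable_fun setT th -> measurable_fun setT (G th).
  move=> mth; apply: (@measurable_integral_itv _ _ _ a
    (fun p => `|X (p.2, p.1) - X (th p.1, p.1)|)) => //.
  exact: (measurable_sweep_part mth (@measurable_snd _ _ R R)).
have G0 th w : (0 <= G th w)%E by apply: integral_ge0 => t _; rewrite lee_fin.
rewrite unlock; apply: (@le_trans _ _ (\int[P]_w G tau w)%E).
  apply: ge0_le_integral_nomeas => w _; first by rewrite lee_fin.
  have -> : path_integral a xi w = \int[mu]_(t in `[0, a]) X (t, w).
    by apply: eq_Rintegral => t; rewrite inE/= in_itv/= => ta; rewrite /X/= clamp_id.
  have -> : sample xi tau w = X (tau w, w) by rewrite /X/= clamp_id.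
  exact: dist_Rintegral_cst.
(* Passing from [tau] to [eta] changes the integrand only on a null set. *)
rewrite (ge0_ae_eq_integral (g := G eta))//; [|exact: mG..|]; last first.
  by apply: filterS htau => w htw _; rewrite /G /eta clamp_id.
have sweepG w : (G eta w =
    \int[mu]_(s in `[0%R, (a - h)%R])
      (`|X (sweep_far a (eta w) s, w) - X (eta w, w)|)%:E +
    \int[mu]_(s in `[0%R, h])
      (`|X (sweep_near a (eta w) s, w) - X (eta w, w)|)%:E)%E.
  rewrite /G (@integral_sweep _ a (eta w) h)//.
  by apply: measurableT_comp => //; apply: measurableT_comp => //; exact: measurable_funB.
have mpart phi b : measurable_fun setT phi -> measurable_fun setT
    (fun w => \int[mu]_(s in `[0%R, b])
      (`|X (phi (eta w, s), w) - X (eta w, w)|)%:E)%E.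
  move=> mphi.
  apply: (@measurable_integral_itv _ _ _ b
    (fun p => `|X (phi (eta p.1, p.2), p.1) - X (eta p.1, p.1)|)) => //.
  exact: measurable_sweep_part.
under eq_integral do rewrite sweepG.
rewrite ge0_integralD//; last 4 first.
- by move=> w _; apply: integral_ge0 => s _; rewrite lee_fin.
- exact: (mpart _ _ (measurable_sweep_far a)).
- by move=> w _; apply: integral_ge0 => s _; rewrite lee_fin.
- exact: (mpart _ _ (measurable_sweep_near a)).
rewrite EFinD [leRHS]addeC; apply: leeD.
  apply: (@sweep_part_le eta (fun p => sweep_far a p.1 p.2)) => // [|w s sh|w s sh].
  - exact: measurable_sweep_far.
  - exact: sweep_far_itv (heta w) sh.
  - exact: sweep_far_dist (heta w) sh.
apply: (@sweep_part_le eta (fun p => sweep_near a p.1 p.2)) => // [|w s sh|w s /andP[s0 _]].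
- exact: measurable_sweep_near.
- exact: sweep_near_itv (heta w) sh.
- exact: sweep_near_dist.
Qed.

End upper_bound.

(** * The extremal process and the lower bound *)

Section lower_bound.
Context d (T : measurableType d) (R : realType) (P : probability T R).
Local Notation mu := (@lebesgue_measure R).
Variables (omega : R -> R) (homega : concave_modulus omega).
Variable a : R.

(** Each x in [0, a] is an endpoint of [h, a - h] for h = min(x, a - x), so the explicit formula
    shows the integral finite. *)
Lemma integral_modulus_dist_fin x : 0 <= x <= a ->
  (\int[mu]_(t in `[0%R, a]) (omega `|t - x|)%:E =
   (\int[mu]_(t in `[0, a]) omega `|t - x|)%:E)%E.
Proof.
move=> /andP[x0 xa]; rewrite fineK//; case: (lerP x (a / 2)) => xa2.
  by rewrite (integral_modulus_dist homega (h := x)) ?x0//; left.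
rewrite (integral_modulus_dist homega (h := a - x)) //; last by right; lra.
by apply/andP; split; lra.
Qed.

(** Subadditivity gives omega|t - y| <= omega|t - x| + e; integrate over [0, a], where the left side
    is explicit because y is an endpoint of [h, a - h]. *)
Lemma Rintegral_modulus_dist_ge h x y e : 0 <= h <= a / 2 -> 0 <= x <= a ->
  y = h \/ y = a - h -> omega `|x - y| <= e ->
  \int[mu]_(s in `[0, h]) omega s + \int[mu]_(s in `[0, a - h]) omega s - a * e
  <= \int[mu]_(t in `[0, a]) omega `|t - x|.
Proof.
move=> hh xa yh xye.
have a0 : 0 <= a by case/andP: xa; exact: le_trans.
have e0 : 0 <= e by rewrite (le_trans _ xye)// (modulus_ge0 homega).
have mx (z : R) : measurable_fun setT (fun t : R => (omega `|t - z|)%:E).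
  apply: measurableT_comp => //; apply: (measurableT_comp (measurable_modulus_norm homega)).
  exact: measurable_funB.
rewrite lerBlDr -lee_fin [leRHS]EFinD -(integral_modulus_dist homega hh yh).
rewrite -integral_modulus_dist_fin//.
have -> : (a * e)%:E = (\int[mu]_(t in `[0%R, a]) (cst e%:E) t)%E.
  rewrite integral_cst//= lebesgue_measure_itv/= lte_fin; case: ifPn => [_|].
    by rewrite oppr0 adde0 -EFinM mulrC.
  by rewrite -leNgt => a_; rewrite (_ : a = 0) ?mul0r ?mule0//; apply/le_anti/andP.
rewrite -ge0_integralD//; last 2 first.
- by move=> t _; rewrite lee_fin (modulus_ge0 homega).
- by apply: measurable_funTS; exact: mx.
apply: ge0_le_integral_nomeas => t _; first by rewrite lee_fin (modulus_ge0 homega).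
rewrite -EFinD lee_fin (le_trans _ (lerD (lexx _) xye))//.
rewrite (le_trans _ (modulus_subadditive homega _ _))// (modulus_le homega)//.
by rewrite (le_trans _ (ler_normD _ _))// addrA subrK.
Qed.

Variables (tau : T -> R) (A : set T).
Hypotheses (mtau : measurable_fun setT tau) (atau : forall w, 0 <= tau w <= a).
Hypotheses (mA : measurable A) (PA0 : (0 < P A)%E).

(* The extremal process is concentrated on an event A on which |tau - a/2|
   is close to its essential supremum. *)
Definition spike (t : R) (w : T) : R := \1_A w / fine (P A) * omega `|t - tau w|.

Let p0 : 0 < fine (P A).
Proof. by rewrite fine_gt0// PA0/= (le_lt_trans (probability_le1 P mA)) ?ltry. Qed.

Let pE : (fine (P A))%:E = P A.
Proof. by rewrite fineK// fin_num_measure. Qed.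

(** The weight 1_A / P(A) is a probability density. *)
Let integral_density c : 0 <= c -> (\int[P]_w (\1_A w / fine (P A) * c)%:E = c%:E)%E.
Proof.
move=> c0.
under eq_integral do rewrite -mulrA mulrC EFinM.
rewrite ge0_integralZl//; last 2 first.
- by apply: measurableT_comp => //; exact: measurable_indic.
- by rewrite lee_fin mulr_ge0// invr_ge0 ltW.
rewrite integral_indic// setIT -[X in (_ * X)%E]pE -EFinM mulrAC mulVf ?mul1r//.
exact: lt0r_neq0.
Qed.

Let measurable_spike :
  measurable_fun setT (fun q : R * T => spike q.1 q.2).
Proof.
apply: measurable_funM.
  apply: measurable_funM => //.
  by apply: (measurableT_comp (measurable_indic _)) => //; exact: measurable_snd.
apply: (measurableT_comp (measurable_modulus_norm homega)).
apply: measurable_funB; first exact: measurable_fst.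
by apply: (measurableT_comp mtau); exact: measurable_snd.
Qed.

Lemma spike_H_class : H_class P omega a spike.
Proof.
split; first exact: measurable_funTS.
move=> th et ath aet.
set N := norm_infty P _.
have tea w : `|th w - et w| <= a.
  have /andP[? ?] := ath w; have /andP[? ?] := aet w.
  by rewrite ler_norml; apply/andP; split; lra.
have N0 : 0 <= N := norm_infty_ge0 P tea.
have mspike (f : {RV P >-> R}) : measurable_fun setT (sample spike f).
  exact: (measurable_fun_comp2 measurable_spike).
(* With the bound written as an integral against the density, an almost sure comparison of
   integrands suffices. *)
rewrite unlock -(integral_density (modulus_ge0 homega N0)).
have ip0 w : 0 <= \1_A w / fine (P A) by rewrite divr_ge0// ltW.
apply: ae_ge0_le_integral => //.
- by apply: measurableT_comp => //; apply: measurableT_comp => //; exact: measurable_funB.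
- by move=> w _; rewrite lee_fin mulr_ge0// (modulus_ge0 homega).
- apply: measurableT_comp => //; apply: measurable_funM => //.
  by apply: measurable_funM => //; exact: measurable_indic.
- apply: filterS (norm_infty_ae P tea) => w Nw _.
  rewrite lee_fin /sample /spike -mulrBr normrM ger0_norm//.
  rewrite ler_wpM2l// (le_trans (modulus_dist homega _ _))//.
  rewrite (modulus_le homega)//.
  by rewrite opprB addrA subrK.
Qed.

Lemma expectation_spike_ge h e : 0 <= h <= a / 2 ->
  (forall w, A w -> exists2 y, y = h \/ y = a - h & omega `|tau w - y| <= e) ->
  ((\int[mu]_(s in `[0, h]) omega s + \int[mu]_(s in `[0, a - h]) omega s - a * e)%:E
   <= 'E_P[fun w => `|path_integral a spike w - a * sample spike tau w|%R])%E.
Proof.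
move=> hh hA; set c := (X in X%:E).
(* [c] may be negative when e is large; its positive part can be averaged against the density. *)
apply: (@le_trans _ _ (Num.max 0 c)%:E); first by rewrite lee_fin le_max lexx orbT.
have c0 : 0 <= Num.max 0 c by rewrite le_max lexx.
rewrite unlock -(integral_density c0).
have ip0 w : 0 <= \1_A w / fine (P A) by rewrite divr_ge0// ltW.
apply: ge0_le_integral_nomeas => w _; rewrite lee_fin; first by rewrite mulr_ge0.
have -> : sample spike tau w = 0.
  by rewrite /sample /spike subrr normr0 (modulus0 homega) mulr0.
rewrite mulr0 subr0.
(* Off [A] the averaged constant vanishes, so only paths with w in [A] matter. *)
have [wA|/negPf wA] := boolP (w \in A); last by rewrite indicE wA !mul0r.
have [y yh ye] := hA w (set_mem wA).
apply: le_trans (ler_norm _).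
rewrite /path_integral /spike RintegralZl//; last first.
  apply/integrableP; split.
    apply/measurable_funTS/measurableT_comp => //.
    apply: (measurableT_comp (measurable_modulus_norm homega)).
    exact: measurable_funB.
  under eq_integral do rewrite /= ger0_norm ?(modulus_ge0 homega)//.
  by rewrite integral_modulus_dist_fin// ltry.
rewrite ler_wpM2l// ge_max Rintegral_ge0 ?andTb; last first.
  by move=> t _; exact: modulus_ge0 homega _ _.
exact: Rintegral_modulus_dist_ge hh (atau w) yh ye.
Qed.

End lower_bound.

(** * The supremum from the two bounds *)

Theorem theorem1 (R : realType) (d : measure_display) (T : measurableType d)
    (P : probability T R) (omega : R -> R) (homega : concave_modulus omega)
    (a : R) (ha : 0 < a) (tau : {RV P >-> R}) (htau : random_times P a tau) :
  let tstar := norm_infty P (fun w => tau w - a / 2) in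
  ereal_sup
    [set ('E_P[fun w => `|path_integral a xi w - a * sample xi tau w|%R])%E
       | xi in H_class P omega a] =
  (\int[lebesgue_measure]_(s in `[0, a / 2 - tstar]) omega s +
   \int[lebesgue_measure]_(s in `[0, a / 2 + tstar]) omega s)%:E.
Proof.
move=> tstar.
have mtau : measurable_fun setT tau by exact: measurable_funP.
have tau2 w : `|tau w - a / 2| <= a / 2.
  by have /andP[? ?] := htau w; rewrite ler_norml; apply/andP; split; lra.
have t0 : 0 <= tstar := norm_infty_ge0 P tau2.
have ta : tstar <= a / 2 := norm_infty_le P tau2.
pose h := a / 2 - tstar.
have hh : 0 <= h <= a / 2 by rewrite /h; apply/andP; split; lra.
have -> : a / 2 + tstar = a - h by rewrite /h; lra.
rewrite -/h; apply/le_anti/andP; split.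
  apply: ge_ereal_sup => _ [xi xiH <-].
  apply: expectation_path_integral_le => //; first exact: ltW.
  apply: filterS (norm_infty_ae P tau2) => w.
  by rewrite -/tstar ler_norml /h => /andP[? ?]; apply/andP; split; lra.
apply/lee_addgt0Pr => e e0.
(* The tolerance e / a makes the total loss a * (e / a) = e. *)
have [del del0 dele] := modulus_small homega (divr_gt0 e0 ha).
have mtau2 : measurable_fun setT (fun w => tau w - a / 2) by exact: measurable_funB.
have := norm_infty_near P mtau2 tau2 del0; rewrite -/tstar; set A := [set w | _] => PA.
have mA : measurable A by exact: measurable_norm_itvoc.
apply: (@le_trans _ _ ('E_P[fun w => `|path_integral a (spike P omega tau A) w -
    a * sample (spike P omega tau A) tau w|%R] + e%:E)%E); last first.
  rewrite leeD2r//; apply: ereal_sup_ubound => /=.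
  by exists (spike P omega tau A) => //; exact: spike_H_class.
rewrite -leeBlDr//.
have -> : e = a * (e / a) by rewrite mulrC divfK ?gt_eqF.
rewrite -EFinB; apply: expectation_spike_ge => // w /andP[tw1 tw2].
have near y : `|tau w - y| <= del -> omega `|tau w - y| <= e / a.
  by move=> yd; rewrite (le_trans _ (ltW dele))// (modulus_le homega).
(* On [A] the sign of tau - a/2 decides which endpoint, a/2 + t* = a - h or a/2 - t* = h, lies
   within [del] of [tau w]. *)
move: tw1 tw2; case: (lerP 0 (tau w - a / 2)) => s0.
  rewrite ger0_norm// => tw1 tw2; exists (a - h); first by right.
  by apply: near; rewrite /h ler_norml; apply/andP; split; lra.
rewrite ltr0_norm// => tw1 tw2; exists h; first by left.
by apply: near; rewrite /h ler_norml; apply/andP; split; lra.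
Qed.
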